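(* There exists an infinite word over the ternary alphabet $\{0,1,2\}$ that is $\tfrac{41}{22}^+$-free and avoids overpals, i.e., has no factor that is an overpal.
   Context: For a nonempty finite word $u$ and a rational $r>1$, a word $v$ is an $r$-power (of $u$) if $v$ is a prefix of the infinite periodic word $uuu\cdots$ and $|v|/|u|=r$. A word is $\beta^+$-free if none of its factors is an $r$-power with $r>\beta$. An overpal is a word of the form $axax^Ra$, where $a$ is a single letter, $x$ is a (possibly empty) finite word, and $x^R$ is the reversal of $x$. *)

(* Defs.v *)
From mathcomp Require Import all_boot all_order all_algebra.

Set Implicit Arguments.
Unset Strict Implicit.
Unset Printing Implicit Defensive.

Import GRing.Theory Num.Theory.
Local Open Scope ring_scope.

Definition infinite_word (T : Type) : Type := nat -> T.

Definition is_prefix (T : Type) (v : seq T) (w : infinite_word T) : Prop :=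
  v = mkseq w (size v).

Definition is_factor (T : Type) (v : seq T) (w : infinite_word T) : Prop :=
  exists i : nat, is_prefix v (fun k => w (i + k)%N).

(* The infinite periodic word uuu... for the nonempty word u = a :: s; the
   index is always in range, so the default value of nth is never used. *)
Definition periodic_word (T : Type) (a : T) (s : seq T) : infinite_word T :=
  fun k => nth a (a :: s) (k %% size (a :: s)).

Definition is_power (T : Type) (r : rat) (v : seq T) : Prop :=
  1 < r /\
  exists (a : T) (s : seq T),
    is_prefix v (periodic_word a s) /\
    (size v)%:R / (size (a :: s))%:R = r.

(* beta^+-freeness: powers of exponent exactly beta are allowed. *)
Definition plus_free (T : Type) (beta : rat) (w : infinite_word T) : Prop :=
  forall v : seq T, is_factor v w ->
  forall r : rat, beta < r -> ~ is_power r v.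

Definition is_overpal (T : Type) (v : seq T) : Prop :=
  exists (a : T) (x : seq T),
    v = [:: a] ++ x ++ [:: a] ++ rev x ++ [:: a].

Definition avoids_overpals (T : Type) (w : infinite_word T) : Prop :=
  forall v : seq T, is_factor v w -> ~ is_overpal v.

(* Main.v *)
Require Import Defs.
From mathcomp Require Import all_boot all_order all_algebra.
From mathcomp Require Import zify.

Set Implicit Arguments.
Unset Strict Implicit.
Unset Printing Implicit Defensive.

Import Order.TTheory GRing.Theory Num.Theory.
Local Open Scope nat_scope.

(** Let [sgn] be the sign word fixed by [+ -> +++--, - -> +++----], let [tern]
    be the ternary word of its partial sums modulo 3, and let [word] be obtained
    from [tern] by replacing its [k]-th letter [t] with [t + 01020] or
    [t + 010201] (modulo 3) according to the [k]-th sign.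

    [word] has no palindrome of length 7, hence no overpal of length at least 7;
    the shorter ones [aaa] and [ababa] are large powers. As for powers,
    if a factor of [tern] or of [word] is repeated at distance [p] and the
    repeated part is long enough to contain a recognisable block boundary, then
    the repetition comes from one in [tern] with a smaller period: both
    possible blocks differ at fixed places near their ends, so the match extends
    by a bounded amount only. The substitution multiplies the weight
    [2|u|_+ + 3|u|_-] by 6 and preserves the weight [|u|_+ - |u|_-] (its matrix
    has eigenvalues 6 and 1), so two linear inequalities between a period and its
    repeated part are inherited from smaller periods, and one of them is the
    exponent bound for [word]. Repetitions without boundary are settled by
    enumeration. *)

(** * The sign word as a fixed point of the substitution *)

Definition psi (b : bool) : seq bool :=
  [:: true; true; true; false; false] ++ (if b then [::] else [:: false; false]).

Definition subst (s : seq bool) : seq bool := flatten (map psi s).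

(** The [k]-th iterate has more than [k] letters, so the default is never reached. *)
Definition sgn (k : nat) : bool := nth true (iter k subst [:: true]) k.

Lemma subst_cat s1 s2 : subst (s1 ++ s2) = subst s1 ++ subst s2.
Proof. by rewrite /subst map_cat flatten_cat. Qed.

Lemma size_subst s : 5 * size s <= size (subst s).
Proof.
elim: s => [|b s IHs] //; by rewrite -cat1s subst_cat !size_cat mulnDr leq_add.
Qed.

Lemma size_iter_subst k : k < size (iter k subst [:: true]).
Proof. by elim: k => //= k IHk; have := size_subst (iter k subst [:: true]); lia. Qed.

(** The image of [true] starts with [true] and [subst] preserves prefixes, so the iterates converge
    to one infinite word. *)
Lemma iter_subst_prefix a b :
  exists s, iter (a + b) subst [:: true] = iter a subst [:: true] ++ s.
Proof.
have step k : exists s, iter k.+1 subst [:: true] = iter k subst [:: true] ++ s.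
  elim: k => [|k [s IHk]]; first by exists [:: true; true; false; false].
  by exists (subst s); rewrite iterS {1}IHk subst_cat.
elim: b => [|b [s IHb]]; first by exists [::]; rewrite addn0 cats0.
have [s' es'] := step (a + b).
by exists (s ++ s'); rewrite addnS es' IHb catA.
Qed.

Lemma nth_iter_subst j k :
  k < size (iter j subst [:: true]) -> nth true (iter j subst [:: true]) k = sgn k.
Proof.
move=> ltk; rewrite /sgn; case: (leqP j k) => [lejk|/ltnW lekj].
  by have [s] := iter_subst_prefix j (k - j); rewrite subnKC // => ->; rewrite nth_cat ltk.
have [s] := iter_subst_prefix k (j - k); rewrite subnKC // => ->.
by rewrite nth_cat size_iter_subst.
Qed.

Lemma mkseq_sgn j n : n <= size (iter j subst [:: true]) ->
  mkseq sgn n = take n (iter j subst [:: true]).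
Proof.
move=> len; apply: (@eq_from_nth _ true); first by rewrite size_mkseq size_takel.
move=> k; rewrite size_mkseq => ltk; rewrite nth_mkseq // nth_take //.
by rewrite nth_iter_subst //; apply: leq_trans len.
Qed.

Lemma subst_sgn k :
  mkseq sgn (size (subst (mkseq sgn k))) = subst (mkseq sgn k).
Proof.
have lek : k <= size (iter k subst [:: true]) := ltnW (size_iter_subst k).
set s := mkseq sgn k.
have es : subst (iter k subst [:: true])
        = subst s ++ subst (drop k (iter k subst [:: true])).
  by rewrite -subst_cat /s (mkseq_sgn lek) cat_take_drop.
rewrite (@mkseq_sgn k.+1) /= es ?size_cat ?leq_addr //.
by rewrite take_size_cat.
Qed.

(** * Weighted counts of signs in prefixes *)

Definition weight A B (s : seq bool) := A * count id s + B * count negb s.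

Definition plus k := count id (mkseq sgn k).
Definition minus k := count negb (mkseq sgn k).
(** With blocks of length [A] for [+] and [B] for [-], this is where block [k] starts: [5 7] for
    [psi], [5 6] for [word]. With [1 2] it is the partial sum behind [tern]. *)
Definition pos A B k := weight A B (mkseq sgn k).

Lemma posE A B k : pos A B k = A * plus k + B * minus k.
Proof. by []. Qed.

Lemma plusS k : plus k.+1 = plus k + sgn k.
Proof. by rewrite /plus mkseqS -cats1 count_cat /= addn0. Qed.

Lemma minusS k : minus k.+1 = minus k + ~~ sgn k.
Proof. by rewrite /minus mkseqS -cats1 count_cat /= addn0. Qed.

Lemma plus_minus k : plus k + minus k = k.
Proof.
elim: k => [|k IHk]; first by [].
by rewrite plusS minusS; case: sgn; lia.
Qed.

Lemma plus_le a b : a <= b -> plus a <= plus b.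
Proof.
by move/subnKC <-; elim: (b - a) => [|c]; rewrite ?addn0 // addnS plusS; lia.
Qed.

Lemma minus_le a b : a <= b -> minus a <= minus b.
Proof.
by move/subnKC <-; elim: (b - a) => [|c]; rewrite ?addn0 // addnS minusS; lia.
Qed.

Lemma pos0 A B : pos A B 0 = 0.
Proof. by rewrite posE /= !muln0. Qed.

Lemma posS A B k : pos A B k.+1 = pos A B k + (if sgn k then A else B).
Proof.
by rewrite !posE plusS minusS !mulnDr; case: (sgn k); rewrite /= !(muln0, muln1, addn0) ?addnA // addnAC.
Qed.

Lemma pos_le A B a b : a <= b -> pos A B a <= pos A B b.
Proof. by move=> ab; rewrite leq_add // leq_mul ?plus_le ?minus_le. Qed.

Lemma pos_addr_le c A B a b :
  c <= A -> c <= B -> pos A B a + c * b <= pos A B (a + b).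
Proof.
move=> cA cB; elim: b => [|b IHb]; first by rewrite muln0 !addn0.
by rewrite mulnS !addnS posS; case: sgn; lia.
Qed.

Lemma pos_floor A B i : 0 < A -> 0 < B ->
  exists k, pos A B k <= i < pos A B k.+1.
Proof.
move=> A0 B0; elim: i => [|i [k /andP[lek ltk]]].
  by exists 0; rewrite posS pos0; case: sgn.
have [ltS|leS] := ltnP i.+1 (pos A B k.+1); first by exists k; lia.
by exists k.+1; rewrite (posS _ _ k.+1); case: (sgn k.+1); lia.
Qed.

(** * Positions and counts under the substitution *)

Lemma size_subst_sgn k : size (subst (mkseq sgn k)) = pos 5 7 k.
Proof.
elim: k => [|k IHk]; first by rewrite pos0.
rewrite mkseqS -cats1 subst_cat size_cat IHk posS; congr (_ + _).
by case: sgn.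
Qed.

Lemma sgn_subst k r : r < size (psi (sgn k)) ->
  sgn (pos 5 7 k + r) = nth true (psi (sgn k)) r.
Proof.
move=> ltr; have e1 := subst_sgn k.+1.
have eS : pos 5 7 k.+1 = pos 5 7 k + size (psi (sgn k)) by rewrite posS; case: sgn.
rewrite size_subst_sgn in e1.
have := congr1 (nth true ^~ (pos 5 7 k + r)) e1; rewrite nth_mkseq ?eS ?ltn_add2l //.
move=> ->; rewrite mkseqS -cats1 subst_cat nth_cat size_subst_sgn ltnNge leq_addr /=.
by rewrite addKn /subst /= cats0.
Qed.

Lemma sgn_substE k :
  [/\ sgn (pos 5 7 k), sgn (pos 5 7 k).+1, sgn (pos 5 7 k).+2,
      sgn (pos 5 7 k).+3 = false & sgn (pos 5 7 k).+4 = false].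
Proof.
have E r : r < 5 -> sgn (pos 5 7 k + r) = nth true (psi (sgn k)) r.
  by move=> lr; rewrite sgn_subst //; apply: leq_trans lr _; case: (sgn k).
by split; [rewrite -[pos _ _ _]addn0|rewrite -addn1|rewrite -addn2|rewrite -addn3|rewrite -addn4];
  rewrite E //; case: (sgn k).
Qed.

(** Offset 5 is a [-] of the longer block, or the initial [+] of the block that follows a shorter
    one. *)
Lemma sgn_subst5 k : sgn (pos 5 7 k + 5) = sgn k.
Proof.
case e: (sgn k); last by rewrite sgn_subst e.
have -> : pos 5 7 k + 5 = pos 5 7 k.+1 by rewrite posS e.
by have [] := sgn_substE k.+1.
Qed.

Lemma sgn_subst6 k : sgn k = false -> sgn (pos 5 7 k + 6) = false.
Proof. by move=> e; rewrite sgn_subst e. Qed.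

Lemma plus_subst k : plus (pos 5 7 k) = 3 * plus k + 3 * minus k.
Proof.
elim: k => [|k IHk]; first by rewrite pos0.
have [s0 s1 s2 s3 s4] := sgn_substE k; have := sgn_subst5 k; have := @sgn_subst6 k.
set i := pos 5 7 k in IHk s0 s1 s2 s3 s4 *.
have plus5 : plus (i + 5) = plus i + 3.
  by rewrite !(addnS, addn0) !plusS s0 s1 s2 s3 s4; lia.
rewrite posS plusS minusS -/i; case: (sgn k) => [_ _|/(_ erefl) s6 s5]; first by lia.
have -> : i + 7 = (i + 5).+2 by lia.
rewrite !plusS s5; have -> : (i + 5).+1 = i + 6 by lia.
by rewrite s6; lia.
Qed.

Lemma minus_subst k : minus (pos 5 7 k) = 2 * plus k + 4 * minus k.
Proof.
have := plus_minus (pos 5 7 k); rewrite plus_subst posE; lia.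
Qed.

(** * The ternary word, its repetitions and their desubstitution *)

Definition tern k := pos 1 2 k %% 3.

Lemma ternS k : tern k.+1 = (tern k + (if sgn k then 1 else 2)) %% 3.
Proof. by rewrite /tern posS modnDml. Qed.

(** The images of [+] and [-] have sums 7 and 11, congruent modulo 3 to the original 1 and 2. *)
Lemma tern_subst k : tern (pos 5 7 k) = tern k.
Proof. rewrite /tern !(posE 1 2) plus_subst minus_subst; lia. Qed.

(** The upper end is inclusive: [m] repeated signs correspond to [m + 1] repeated letters. *)
Definition periodic i n m := forall k, i <= k <= i + m -> tern (k + n) = tern k.

Lemma periodic_sgn i n m k : periodic i n m -> i <= k < i + m -> sgn (k + n) = sgn k.
Proof.
move=> H hk; have := H k.+1; have := H k; rewrite !addSn !ternS.
have : tern k < 3 by rewrite ltn_mod.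
by case: (sgn (k + n)); case: (sgn k) => //; lia.
Qed.

Lemma periodic_plus i n m k : periodic i n m -> i <= k <= i + m ->
  plus (k + n) + plus i = plus k + plus (i + n) /\
  minus (k + n) + minus i = minus k + minus (i + n).
Proof.
move=> H /andP[/subnKC <-]; elim: (k - i) => [|c IHc] hc; first by rewrite !addn0; lia.
have [] := IHc; first by lia.
have -> : i + c.+1 + n = (i + c + n).+1 by lia.
rewrite [i + c.+1]addnS !plusS !minusS (@periodic_sgn i n m (i + c) H); first lia.
by lia.
Qed.

Lemma periodic_pos A B i n m k : periodic i n m -> i <= k <= i + m ->
  pos A B (k + n) + pos A B i = pos A B k + pos A B (i + n).
Proof.
move=> H hk; have [e1 e2] := periodic_plus H hk.
by rewrite !posE addnACA [RHS]addnACA -!mulnDr e1 e2.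
Qed.

Lemma periodicS i n m :
  periodic i n m -> sgn (i + m + n) = sgn (i + m) -> periodic i n m.+1.
Proof.
move=> H es k /andP[lek]; rewrite addnS leq_eqVlt => /predU1P[->|]; last first.
  by rewrite ltnS => ltk; apply: H; rewrite lek.
by rewrite addSn !ternS es H ?leqnn ?andbT ?leq_addr.
Qed.

Lemma periodic_pred i n m :
  periodic i.+1 n m -> sgn (i + n) = sgn i -> periodic i n m.+1.
Proof.
move=> H es k /andP[]; rewrite leq_eqVlt => /predU1P[<- _|lek ltk]; last first.
  by apply: H; rewrite lek addSnnS.
have := H i.+1; rewrite leqnn leq_addr addSn !ternS es => /(_ isT).
have : tern i < 3 by rewrite ltn_mod.
have : tern (i + n) < 3 by rewrite ltn_mod.
by case: (sgn i); lia.
Qed.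

(* [F] is the offset, from the start of a block, of a letter that reveals the sign
   of the block; the letter 3 places before the end of a block does the same. *)
Lemma desubstitution A B F (x : nat -> nat) i e p I N :
    3 <= A -> 3 <= B ->
    (forall k l, tern k = tern l ->
      x (pos A B k + F) = x (pos A B l + F) -> sgn k = sgn l) ->
    (forall k l, tern k.+1 = tern l.+1 ->
      x (pos A B k.+1 - 3) = x (pos A B l.+1 - 3) -> sgn k = sgn l) ->
    (forall j, i <= j < i + e -> x (j + p) = x j) ->
    i <= pos A B I < i + e -> pos A B (I + N) = pos A B I + p ->
    tern (I + N) = tern I ->
  exists i' m, [/\ i' <= I <= i' + m, periodic i' N m, pos A B i' <= i + 2
                 & i + e <= pos A B (i' + m) + F].
Proof.
move=> A3 B3 next prev per hI hN tI.
have shift i' m k : i' <= I <= i' + m -> periodic i' N m -> i' <= k <= i' + m ->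
    pos A B (k + N) = pos A B k + p.
  move=> hI' H hk; have := periodic_pos A B H hk; have := periodic_pos A B H hI'; lia.
have fwd c : exists M, periodic I N M /\ (c <= M \/ i + e <= pos A B (I + M) + F).
  elim: c => [|c [M [H [leM|]]]]; last by exists M; split; [|right].
    by exists 0; split; [move=> k hk; have -> : k = I by lia | left].
  have [done|lt] := leqP (i + e) (pos A B (I + M) + F); first by exists M; split; [|right].
  exists M.+1; split; last by left.
  apply: periodicS => //; apply: next; first by apply: H; lia.
  have hI' : I <= I <= I + M by lia.
  rewrite (shift I M (I + M)) //; last by lia.
  rewrite addnAC.
  apply: per; have := @pos_le A B I (I + M); lia.
have [M [HM hM]] : exists M, periodic I N M /\ i + e <= pos A B (I + M) + F.
  have [M [H [leM|]]] := fwd e; exists M; split=> //.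
  have := @pos_addr_le 1 A B I M; lia.
have bwd c : exists i' m, [/\ i' + m = I + M, i' <= I, periodic i' N m
    & i' <= I - c \/ pos A B i' <= i + 2].
  elim: c => [|c [i' [m [em leI H [lei|]]]]]; last by exists i', m; split=> //; right.
    by exists I, M; split=> //; left; rewrite subn0.
  have [done|lt] := leqP (pos A B i') (i + 2); first by exists i', m; split=> //; right.
  case: i' em leI H lei lt => [|i'] em leI H lei lt; first by rewrite pos0 in lt.
  exists i', m.+1; split; [lia|lia| |left; lia].
  have hi : i'.+1 <= I <= i'.+1 + m by lia.
  apply: (periodic_pred H); apply: prev; first by rewrite -addSn; apply: H; lia.
  have -> : pos A B (i' + N).+1 - 3 = pos A B i'.+1 - 3 + p.
    by rewrite -addSn (shift _ _ _ hi H) ?leqnn ?leq_addr //; lia.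
  apply: per; have := @pos_le A B i'.+1 I; lia.
(* After [I] steps to the left the block index is 0, at position 0. *)
have [i' [m [em leI H hi']]] := bwd I; exists i', m; split=> //; first by lia.
  by case: hi' => [|//]; rewrite subnn leqn0 => /eqP->; rewrite pos0.
by rewrite em.
Qed.

(** The first five signs of a block sum to 7, and the sixth sign read is [sgn k] itself. *)
Lemma tern_next k l : tern k = tern l ->
  tern (pos 5 7 k + 6) = tern (pos 5 7 l + 6) -> sgn k = sgn l.
Proof.
have E j : tern (pos 5 7 j + 6) = (tern j + 1 + if sgn j then 1 else 2) %% 3.
  have [s0 s1 s2 s3 s4] := sgn_substE j; have := sgn_subst5 j.
  rewrite -(tern_subst j) => s5; have -> : pos 5 7 j + 6 = (pos 5 7 j + 5).+1 by lia.
  rewrite ternS s5; have -> : pos 5 7 j + 5 = (pos 5 7 j).+4.+1 by lia.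
  by rewrite !ternS s0 s1 s2 s3 s4; case: (sgn j); lia.
rewrite !E => ->; have : tern l < 3 by rewrite ltn_mod.
by case: (sgn k); case: (sgn l) => //; lia.
Qed.

(** The last three signs are [+--] or [---], with sums 2 and 0 modulo 3. *)
Lemma tern_prev k l : tern k.+1 = tern l.+1 ->
  tern (pos 5 7 k.+1 - 3) = tern (pos 5 7 l.+1 - 3) -> sgn k = sgn l.
Proof.
have E j : tern j.+1 = (tern (pos 5 7 j.+1 - 3) + if sgn j then 2 else 0) %% 3.
  have [s0 s1 s2 s3 s4] := sgn_substE j; have := sgn_subst5 j; have := @sgn_subst6 j.
  rewrite -tern_subst posS; case: (sgn j) => [_ _|/(_ erefl) s6 s5].
    have -> : pos 5 7 j + 5 - 3 = (pos 5 7 j).+2 by lia.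
    have -> : pos 5 7 j + 5 = (pos 5 7 j).+2.+3 by lia.
    by rewrite !ternS s2 s3 s4; lia.
  have -> : pos 5 7 j + 7 - 3 = (pos 5 7 j).+4 by lia.
  have -> : pos 5 7 j + 7 = (pos 5 7 j + 6).+1 by lia.
  rewrite ternS s6; have -> : pos 5 7 j + 6 = (pos 5 7 j + 5).+1 by lia.
  rewrite ternS s5; have -> : pos 5 7 j + 5 = (pos 5 7 j).+4.+1 by lia.
  by rewrite ternS s4; lia.
rewrite !E => e1 e2; move: e1; rewrite e2.
have : tern (pos 5 7 l.+1 - 3) < 3 by rewrite ltn_mod.
by case: (sgn k); case: (sgn l) => //; lia.
Qed.

(** Inside a block all [+] precede all [-], so [-+] occurs only where two blocks meet. *)
Lemma subst_boundary b : sgn b = false -> sgn b.+1 -> exists k, b.+1 = pos 5 7 k.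
Proof.
move=> sb sb1; have [k /andP[lek]] := @pos_floor 5 7 b.+1 isT isT.
rewrite leq_eqVlt in lek; case/predU1P: lek => [<- _|ltk]; first by exists k.
have [s0 s1 s2 s3 s4] := sgn_substE k; have := sgn_subst5 k; have := @sgn_subst6 k.
move=> s6 s5; rewrite posS => ltS; exfalso.
have {ltk} [r [hr eb]] : exists r, r < 6 /\ b = pos 5 7 k + r.
  by exists (b - pos 5 7 k); move: ltS; case: (sgn k); lia.
case es: (sgn k); rewrite es in s5 s6 ltS.
  by case: r hr eb => [|[|[|[|r]]]] hr eb; [..|lia];
    rewrite eb !(addnS, addn0) ?s0 ?s1 ?s2 ?s3 ?s4 in sb sb1.
have {}s6 := s6 erefl.
by case: r hr eb => [|[|[|[|[|[|r]]]]]] hr eb; [..|lia];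
  rewrite eb ?(addnS, addn0) in sb sb1 s5 s6; rewrite ?s0 ?s1 ?s2 ?s3 ?s4 ?s5 ?s6 in sb sb1.
Qed.

(* [pos 2 3] is the eigenvector of the substitution for 6, and [pos 5 6] measures
   lengths in [word]. Substitution turns a repeated part of weight [h] into one of
   weight at most [6 h + 18], and [6 h + 18 + 18 / 5 = 6 (h + 18 / 5)]. A repeated
   part [v] of [sgn] yields one of length at most [|v| + 9] in [word], where [|v|]
   is its [pos 5 6]-weight, and exponent 41/22 allows it to be 19/22 of the
   period. *)
Definition bounded i n m :=
  22 * (5 * (pos 2 3 (i + m) - pos 2 3 i) + 18) <= 95 * (pos 2 3 (i + n) - pos 2 3 i)
  /\ 22 * (pos 5 6 (i + m) - pos 5 6 i + 9) <= 19 * (pos 5 6 (i + n) - pos 5 6 i).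

(** The added weight 18 is at most 6 from two signs on the left and 12 from [+++--] on the right. *)
Lemma bounded_subst i n m I N i' m' :
    periodic i n m -> i <= pos 5 7 I <= i + m -> pos 5 7 (I + N) = pos 5 7 I + n ->
    periodic i' N m' -> i' <= I <= i' + m' ->
    pos 5 7 i' <= i + 2 -> i + m <= pos 5 7 (i' + m') + 5 ->
  bounded i' N m' -> bounded i n m.
Proof.
move=> H hI hN H' hI' left right.
have [p1 m1] := periodic_plus H hI; have [p2 m2] := periodic_plus H' hI'.
rewrite -hN plus_subst (plus_subst I) in p1; rewrite -hN minus_subst (minus_subst I) in m1.
have pl := plus_le left; have ml := minus_le left.
have pr := plus_le right; have mr := minus_le right.
have [s0 s1 s2 s3 s4] := sgn_substE (i' + m').
have e5 j : j + 5 = j.+4.+1 by lia.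
rewrite e5 !plusS s0 s1 s2 s3 s4 in pr; rewrite e5 !minusS s0 s1 s2 s3 s4 in mr.
rewrite (plus_subst i') in pl; rewrite (minus_subst i') in ml.
rewrite (plus_subst (i' + m')) in pr; rewrite (minus_subst (i' + m')) in mr.
have pi : plus (i + 2) + minus (i + 2) = plus i + minus i + 2 by rewrite !plus_minus.
have [pi1 mi1] : plus i <= plus (i + 2) /\ minus i <= minus (i + 2).
  by split; [apply: plus_le | apply: minus_le]; rewrite leq_addr.
(* This and the next three facts make the truncated subtractions in [bounded] exact. *)
have [a1 a2] : plus i <= plus (i + m) /\ minus i <= minus (i + m).
  by split; [apply: plus_le | apply: minus_le]; rewrite leq_addr.
have [b1 b2] : plus i' <= plus (i' + m') /\ minus i' <= minus (i' + m').
  by split; [apply: plus_le | apply: minus_le]; rewrite leq_addr.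
have [c1 c2] : plus i' <= plus (i' + N) /\ minus i' <= minus (i' + N).
  by split; [apply: plus_le | apply: minus_le]; rewrite leq_addr.
have [d1 d2] : plus i <= plus (i + n) /\ minus i <= minus (i + n).
  by split; [apply: plus_le | apply: minus_le]; rewrite leq_addr.
rewrite /bounded !posE => -[]; clear - pl ml pr mr p1 p2 m1 m2 pi pi1 mi1 a1 a2 b1 b2 c1 c2 d1 d2.
by move=> e1 e2; split; lia.
Qed.

(** * Enumeration of short factors of the sign word *)

Lemma subst2_sgn k :
  mkseq sgn (pos 5 7 (pos 5 7 k)) = subst (subst (mkseq sgn k)).
Proof. by rewrite -(subst_sgn k) -[RHS]subst_sgn !size_subst_sgn. Qed.

Lemma nth_subst2 k r : r < size (subst (psi (sgn k) ++ psi (sgn k.+1))) ->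
  sgn (pos 5 7 (pos 5 7 k) + r) = nth true (subst (psi (sgn k) ++ psi (sgn k.+1))) r.
Proof.
have ek : mkseq sgn k.+2 = mkseq sgn k ++ [:: sgn k; sgn k.+1].
  by rewrite !mkseqS -!cats1 -catA.
have := subst2_sgn k.+2; rewrite ek !subst_cat -subst2_sgn -subst_cat /=.
rewrite {2}/subst /= cats0 => e ltr.
have := congr1 (nth true ^~ (pos 5 7 (pos 5 7 k) + r)) e.
have := congr1 size e; rewrite size_cat !size_mkseq => es.
rewrite nth_mkseq; last by rewrite es ltn_add2l.
by move=> ->; rewrite nth_cat size_mkseq ltnNge leq_addr addKn.
Qed.

Definition window L i := mkseq (fun r => sgn (i + r)) L.

(* [i] lies in the image of one letter under the square of the substitution, an
   image of length at least 29, so a window of length at most 29 is covered by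
   the images of two letters. *)
Definition windows L : seq (seq bool) :=
  [seq take L (drop o (subst (psi bc.1 ++ psi bc.2)))
     | bc <- [:: (true, true); (true, false); (false, true); (false, false)],
       o <- iota 0 (size (subst (psi bc.1)))].

Lemma window_in L i : L <= 29 -> window L i \in windows L.
Proof.
move=> leL; have [k' /andP[lek' ltk']] := @pos_floor 5 7 i isT isT.
have [k /andP[lek ltk]] := @pos_floor 5 7 k' isT isT.
have lei : pos 5 7 (pos 5 7 k) <= i by apply: leq_trans (pos_le _ _ lek) lek'.
have size2 j : pos 5 7 (pos 5 7 j.+1) = pos 5 7 (pos 5 7 j) + size (subst (psi (sgn j))).
  have := congr1 size (subst2_sgn j.+1).
  by rewrite mkseqS -cats1 !subst_cat -subst2_sgn size_cat !size_mkseq {2}/subst /= cats0.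
have lti : i < pos 5 7 (pos 5 7 k.+1) := leq_trans ltk' (pos_le _ _ ltk).
rewrite size2 in lti.
set s := psi (sgn k) ++ psi (sgn k.+1).
have les : i - pos 5 7 (pos 5 7 k) + L <= size (subst s).
  rewrite /s subst_cat size_cat leq_add //; first by lia.
  by apply: leq_trans leL _; case: (sgn k.+1).
have -> : window L i = take L (drop (i - pos 5 7 (pos 5 7 k)) (subst s)).
  apply: (@eq_from_nth _ true) => [|r]; rewrite size_mkseq ?size_takel ?size_drop //; first by lia.
  by move=> ltr; rewrite nth_mkseq // nth_take // nth_drop -nth_subst2 -/s ?addnA ?subnKC //; lia.
apply/allpairsPdep; exists (sgn k, sgn k.+1), (i - pos 5 7 (pos 5 7 k)).
split=> //; first by case: (sgn k); case: (sgn k.+1).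
by rewrite mem_iota add0n ltn_subLR.
Qed.

Lemma pos_window A B i L : pos A B (i + L) = pos A B i + weight A B (window L i).
Proof.
rewrite /weight /window; elim: L => [|L IHL]; first by rewrite addn0 !muln0 !addn0.
rewrite mkseqS -cats1 !count_cat !mulnDr addnS posS IHL /=.
by case: (sgn (i + L)); rewrite /= !(muln0, muln1, addn0) !addnA // addnAC.
Qed.

Lemma tern_window i L : tern (i + L) = (tern i + weight 1 2 (window L i)) %% 3.
Proof. by rewrite /tern pos_window modnDml. Qed.

Lemma take_window L M i : L <= M -> take L (window M i) = window L i.
Proof. by move=> LM; rewrite /window /mkseq -map_take take_iota (minn_idPl LM). Qed.

(** Sums are taken from the start of the window, so the unknown first letter cancels. Indices reach
    at most [7 + 14], within 22 signs. *)
Definition bounded_window (s : seq bool) :=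
  let wt A B k := weight A B (take k s) in
  all (fun n => all (fun m =>
    if all (fun k => wt 1 2 (k + n) == wt 1 2 k %[mod 3]) (iota 0 m.+1) then
      (22 * (5 * wt 2 3 m + 18) <= 95 * wt 2 3 n)
      && (22 * (wt 5 6 m + 9) <= 19 * wt 5 6 n)
    else true) (iota 0 8)) (iota 1 14).

Lemma bounded_windows : all bounded_window (windows 22).
Proof. by vm_compute. Qed.

Lemma periodic_bounded i n m : 0 < n -> periodic i n m -> bounded i n m.
Proof.
elim/ltn_ind: n i m => n IHn i m n0 H.
(* Among 8 consecutive signs some "-+" occurs, which marks a block boundary. *)
have [m8|m7] := leqP 8 m.
  have [k [lek ltk]] : exists k, i < pos 5 7 k /\ pos 5 7 k <= i + 7.
    have [k /andP[lek ltk]] := @pos_floor 5 7 i isT isT.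
    by exists k.+1; move: ltk; rewrite posS; case: (sgn k); lia.
  case: k lek ltk => [|k]; first by rewrite pos0.
  set b := pos 5 7 k.+1 => lek ltk.
  have [s0 _ _ _ _] := sgn_substE k.+1; rewrite -/b in s0.
  have sb : sgn b.-1 = false.
    have [_ _ _ _ s4] := sgn_substE k; move: (@sgn_subst6 k); rewrite /b posS.
    case: (sgn k) => [_|/(_ erefl) <-]; last by rewrite addnS.
    by rewrite -s4 addnS addn4.
  (* The repetition carries the pair [-+] at [b] to [b + n], which is therefore a boundary too. *)
  have [J eJ] : exists J, (b.-1 + n).+1 = pos 5 7 J.
    apply: subst_boundary; first by rewrite (periodic_sgn H) //; lia.
    by rewrite -addSn (periodic_sgn H) //; lia.
  have ltJ : k.+1 < J.
    by rewrite ltnNge; apply/negP => /(pos_le 5 7); rewrite -/b; lia.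
  have eN : k.+1 + (J - k.+1) = J by lia.
  have [||||i' [m' [hI H' left right]]] :=
      @desubstitution 5 7 6 tern i m.+1 n k.+1 (J - k.+1) isT isT tern_next tern_prev.
  - by move=> j hj; apply: H; lia.
  - by rewrite -/b; lia.
  - by rewrite eN -eJ -/b; lia.
  - by rewrite eN -(tern_subst J) -(tern_subst k.+1) -eJ -/b -addSn (ltn_predK lek) H //; lia.
  apply: (@bounded_subst i n m k.+1 (J - k.+1) i' m'); rewrite -/b ?eN //; try lia.
  apply: IHn => //; last by lia.
  have := @pos_addr_le 5 5 7 k.+1 (J - k.+1) isT isT; rewrite eN -eJ -/b; lia.
(* For [m <= 7] and [n >= 15], bounding weights by lengths suffices; the tighter case is
   [22 * (5 * 21 + 18) <= 95 * 30]. *)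
have [n15|n14] := leqP 15 n.
  have := plus_minus (i + m); have := plus_minus i; have := plus_minus (i + n).
  have [a1 a2] : plus i <= plus (i + m) /\ minus i <= minus (i + m).
    by split; [apply: plus_le | apply: minus_le]; rewrite leq_addr.
  have [d1 d2] : plus i <= plus (i + n) /\ minus i <= minus (i + n).
    by split; [apply: plus_le | apply: minus_le]; rewrite leq_addr.
  by rewrite /bounded !posE => e1 e2 e3; split; lia.
have := allP bounded_windows _ (@window_in 22 i isT).
move=> /allP/(_ n); rewrite mem_iota n0 ltnS => /(_ n14).
move=> /allP/(_ m); rewrite mem_iota ltnS => /(_ m7).
have E A B k : k <= 22 -> weight A B (take k (window 22 i)) = pos A B (i + k) - pos A B i.
  by move=> lek; rewrite take_window // pos_window addKn.
rewrite !E; [|lia..]; rewrite ifT; first by case/andP.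
apply/allP => k; rewrite mem_iota add0n /= => ltk; rewrite !take_window; [|lia..].
by rewrite -(eqn_modDl (tern i)) -!tern_window addnA H //; lia.
Qed.

(** * The word built from blocks, and recognition of its blocks *)

Definition block (t : nat) (b : bool) : seq nat :=
  [seq (t + c) %% 3 | c <- [:: 0; 1; 0; 2; 0] ++ (if b then [::] else [:: 1])].

Fixpoint decode (t : nat) (s : seq bool) : seq nat :=
  if s is b :: s' then block t b ++ decode ((t + (if b then 1 else 2)) %% 3) s'
  else [::].

Lemma decode_cons t b s :
  decode t (b :: s) = block t b ++ decode ((t + (if b then 1 else 2)) %% 3) s.
Proof. by []. Qed.

Lemma size_decode t s : size (decode t s) = weight 5 6 s.
Proof.
elim: s t => [|b s IHs] t //=; rewrite size_cat IHs /weight /block size_map.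
by case: b => /=; lia.
Qed.

Lemma decode_cat t s1 s2 : t < 3 ->
  decode t (s1 ++ s2) = decode t s1 ++ decode ((t + weight 1 2 s1) %% 3) s2.
Proof.
elim: s1 t => [|b s1 IHs] t t3; first by rewrite /= addn0 modn_small.
rewrite cat_cons !decode_cons IHs ?ltn_mod // -catA modnDml -addnA.
suff -> : weight 1 2 (b :: s1) = (if b then 1 else 2) + weight 1 2 s1 by [].
 by rewrite /weight; case: b => /=; lia.
Qed.

Lemma block_rot t u b : block ((t + u) %% 3) b = [seq (t + c) %% 3 | c <- block u b].
Proof.
by rewrite /block -map_comp; apply: eq_map => c /=; rewrite modnDml modnDmr addnA.
Qed.

Lemma decode_rot t u s : decode ((t + u) %% 3) s = [seq (t + c) %% 3 | c <- decode u s].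
Proof.
elim: s u => [|b s IHs] u //.
by rewrite !decode_cons map_cat -IHs block_rot modnDmr modnDml addnA.
Qed.

Definition word n := nth 0 (decode 0 (mkseq sgn n.+1)) n.

Lemma mkseq_window k L : mkseq sgn (k + L) = mkseq sgn k ++ window L k.
Proof.
elim: L => [|L IHL]; first by rewrite addn0 cats0.
by rewrite addnS mkseqS IHL /window mkseqS rcons_cat.
Qed.

Lemma word_decode M n : n < pos 5 6 M -> word n = nth 0 (decode 0 (mkseq sgn M)) n.
Proof.
move=> ltn; rewrite /word.
have ltn1 : n < pos 5 6 n.+1 by have := @pos_addr_le 1 5 6 0 n.+1 isT isT; rewrite pos0 mul1n.
have [le|/ltnW le] := leqP M n.+1; rewrite -(subnKC le) mkseq_window decode_cat // nth_cat;
  by rewrite size_decode ?ltn ?ltn1.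
Qed.

Lemma word_window L k r : r < weight 5 6 (window L k) ->
  word (pos 5 6 k + r) = nth 0 (decode (tern k) (window L k)) r.
Proof.
move=> ltr; rewrite (@word_decode (k + L)) ?pos_window ?ltn_add2l //.
rewrite mkseq_window decode_cat // nth_cat size_decode -/(pos 5 6 k).
by rewrite ltnNge leq_addr addKn.
Qed.

Lemma word_nth k r : r < 15 ->
  word (pos 5 6 k + r) = nth 0 (decode (tern k) [:: sgn k; sgn k.+1; sgn k.+2]) r.
Proof.
have -> : [:: sgn k; sgn k.+1; sgn k.+2] = window 3 k.
  by rewrite /window /mkseq /= addn0 addn1 addn2.
move=> ltr; apply: word_window; apply: leq_trans ltr _.
by rewrite /window /mkseq /weight /=; do 3!case: sgn.
Qed.

Lemma tern_cases k : [\/ tern k = 0, tern k = 1 | tern k = 2].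
Proof.
have : tern k < 3 by rewrite ltn_mod.
by case: (tern k) => [|[|[|]]] // _; [constructor 1|constructor 2|constructor 3].
Qed.

Lemma word_pos k : word (pos 5 6 k) = tern k.
Proof. by rewrite -[pos 5 6 k]addn0 word_nth //= addn0 modn_mod. Qed.

Lemma word_block k :
  word (pos 5 6 k).+2 = word (pos 5 6 k) /\ word (pos 5 6 k).+4 = word (pos 5 6 k).
Proof.
split; [rewrite -addn2 | rewrite -addn4];
  by rewrite word_nth // word_pos /= addn0 modn_mod.
Qed.

(* Within [word] the pattern [xyxzx] starts only at block starts. *)
Lemma word_boundary j : word j.+2 = word j -> word j.+4 = word j -> exists k, j = pos 5 6 k.
Proof.
have [k /andP[lek ltk]] := @pos_floor 5 6 j isT isT.
have [r ej] : exists r, j = pos 5 6 k + r by exists (j - pos 5 6 k); lia.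
rewrite posS ej ltn_add2l in ltk; rewrite {j lek}ej.
have r6 : r < 6 by move: ltk; case: (sgn k) => // /ltnW.
rewrite -!addnS !word_nth; try lia.
case: r r6 ltk => [|r] r6 ltk; first by exists k; rewrite addn0.
move=> e1 e2; exfalso; move: ltk e1 e2.
case: (tern_cases k) => ->; case: (sgn k); case: (sgn k.+1); case: (sgn k.+2);
  by case: r r6 => [|[|[|[|[|r]]]]].
Qed.

(** With [t = tern k], offset 7 carries [t + 1] after a [+] and [t] after a [-], modulo 3. *)
Lemma word_next k l : tern k = tern l ->
  word (pos 5 6 k + 7) = word (pos 5 6 l + 7) -> sgn k = sgn l.
Proof.
rewrite !word_nth // => ->.
case: (tern_cases l) => ->; case: (sgn k); case: (sgn k.+1); case: (sgn l); by case: (sgn l.+1).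
Qed.

Lemma word_prev k l : tern k.+1 = tern l.+1 ->
  word (pos 5 6 k.+1 - 3) = word (pos 5 6 l.+1 - 3) -> sgn k = sgn l.
Proof.
have E j : word (pos 5 6 j.+1 - 3) = (tern j.+1 + if sgn j then 2 else 0) %% 3.
  have -> : pos 5 6 j.+1 - 3 = pos 5 6 j + (if sgn j then 2 else 3).
    by rewrite posS; case: (sgn j); lia.
  rewrite word_nth ?ternS; last by case: (sgn j).
  by case: (tern_cases j) => ->; case: (sgn j).
rewrite !E => ->; by case: (tern_cases l.+1) => ->; case: (sgn k); case: (sgn l).
Qed.

(** * The exponent bound *)

(** Five blocks have at least 25 letters, while the indices compared are at most [5 + 8 + 10]. *)
Definition free_window (s : seq bool) :=
  all (fun r => let l := drop r (decode 0 (take 5 s)) in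
    all (fun p => has (fun k => nth 0 l (k + p) != nth 0 l k %[mod 3]) (iota 0 (19 * p %/ 22).+1))
      (iota 1 10)) (iota 0 6).

Lemma free_windows : all free_window (windows 22).
Proof. by vm_compute. Qed.

(** Here [e] is the length beyond one period [p], so the bound says [(p + e) / p <= 41/22]. *)
Lemma word_exponent i p e : 0 < p ->
  (forall j, i <= j < i + e -> word (j + p) = word j) -> 22 * e <= 19 * p.
Proof.
move=> p0 H; have [k /andP[lek ltk]] := @pos_floor 5 6 i isT isT.
(* Some block starts at offset at most 5, and the five letters that identify it end at offset at
   most 9. *)
have [e10|e9] := leqP 10 e.
  have [I [leI ltI]] : exists I, i <= pos 5 6 I /\ pos 5 6 I <= i + 5.
    move: lek; rewrite leq_eqVlt => /predU1P[<-|ltik]; first by exists k; lia.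
    by exists k.+1; move: ltk; rewrite posS; case: (sgn k); lia.
  have [w2 w4] := word_block I.
  have [||J eJ] := @word_boundary (pos 5 6 I + p).
  - have -> : (pos 5 6 I + p).+2 = (pos 5 6 I).+2 + p by lia.
    by rewrite !H //; lia.
  - have -> : (pos 5 6 I + p).+4 = (pos 5 6 I).+4 + p by lia.
    by rewrite !H //; lia.
  have ltJ : I < J by rewrite ltnNge; apply/negP => /(pos_le 5 6); lia.
  have eN : I + (J - I) = J by lia.
  have [|||i' [m [hI H' left right]]] :=
      @desubstitution 5 6 7 word i e p I (J - I) isT isT word_next word_prev H.
  - by lia.
  - by rewrite eN.
  - by rewrite eN -!word_pos -eJ H //; lia.
  have JI : 0 < J - I by lia.
  (* The 9 in [bounded] absorbs the 2 letters lost on the left and 7 on the right. *)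
  have [_] := periodic_bounded JI H'.
  have := periodic_pos 5 6 H' hI; have := @pos_le 5 6 i' (i' + m) (leq_addr _ _).
  have := @pos_le 5 6 i' (i' + (J - I)) (leq_addr _ _).
  by rewrite eN -eJ; lia.
(* Otherwise [19 * p < 22 * e <= 198], which leaves periods up to 10. *)
rewrite leqNgt; apply/negP => lt; have p10 : p < 11 by lia.
have [r er] : exists r, i = pos 5 6 k + r by exists (i - pos 5 6 k); lia.
have r6 : r < 6 by move: ltk; rewrite posS er; case: (sgn k); lia.
have := allP free_windows _ (@window_in 22 k isT).
move=> /allP/(_ r); rewrite mem_iota r6 => /(_ isT).
move=> /allP/(_ p); rewrite mem_iota p0 p10 => /(_ isT).
rewrite take_window //.
have w5 : 25 <= weight 5 6 (window 5 k) by rewrite /window /mkseq /weight /=; do 5!case: sgn.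
have W c : r + c < 25 ->
    word (i + c) = (tern k + nth 0 (drop r (decode 0 (window 5 k))) c) %% 3.
  move=> lt25; rewrite er -addnA (@word_window 5); last by lia.
  have -> : decode (tern k) (window 5 k) = [seq (tern k + x) %% 3 | x <- decode 0 (window 5 k)].
    by rewrite -decode_rot addn0 modn_mod.
  by rewrite (nth_map 0) ?nth_drop // size_decode; lia.
case/hasP => c; rewrite mem_iota add0n /= => ltc /negP; apply.
have : word (i + c + p) = word (i + c) by apply: H; lia.
by rewrite -addnA !W; [move/eqP; rewrite eqn_modDl|lia..].
Qed.

(** * Palindromes and overpals, over the alphabet ['I_3] *)

(** Seven letters starting inside a block end at offset at most 11, within three blocks, so finitely
    many cases remain. *)
Lemma word_palindrome i : ~ (forall j, j < 3 -> word (i + j) = word (i + 6 - j)).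
Proof.
have [k /andP[lek ltk]] := @pos_floor 5 6 i isT isT.
have [r er] : exists r, i = pos 5 6 k + r by exists (i - pos 5 6 k); lia.
have r6 : r < 6 by move: ltk; rewrite posS er; case: (sgn k); lia.
move=> H; have := H 0 isT; have := H 1 isT; have := H 2 isT.
rewrite er -!addnBA // -!(addnA (pos 5 6 k)) !word_nth; try lia.
case: (tern_cases k) => ->; case: (sgn k); case: (sgn k.+1); case: (sgn k.+2);
  by case: r r6 {er} => [|[|[|[|[|[|r]]]]]].
Qed.

Lemma word_lt3 n : word n < 3.
Proof.
(* Rotation by 0 exhibits every letter as a residue modulo 3. *)
rewrite /word -[decode 0]/(decode ((0 + 0) %% 3)) decode_rot.
have [lt|ge] := ltnP n (size (decode 0 (mkseq sgn n.+1))).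
  by rewrite (nth_map 0) // ltn_mod.
by rewrite nth_default // size_map.
Qed.

Definition word3 : infinite_word 'I_3 := fun n => Ordinal (word_lt3 n).

Lemma word3_inj i j : word3 i = word3 j -> word i = word j.
Proof. by move/(congr1 val). Qed.

Lemma is_factorP (T : Type) (x0 : T) (v : seq T) (w : infinite_word T) :
  is_factor v w -> exists i, forall k, k < size v -> nth x0 v k = w (i + k).
Proof. by case=> i ev; exists i => k ltk; rewrite ev nth_mkseq. Qed.

Lemma word3_plus_free : plus_free (41%:R / 22%:R)%R word3.
Proof.
move=> v /(is_factorP ord0)[i ev] r ltr [_ [a [s [pv er]]]].
set p := size (a :: s) in er.
have lt : 41 * p < 22 * size v.
  move: ltr; rewrite -er ltr_pdivlMr ?ltr0n // mulrAC ltr_pdivrMr ?ltr0n //.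
  by rewrite -!natrM ltr_nat mulnC [in X in _ < X]mulnC.
suff : 22 * (size v - p) <= 19 * p by lia.
apply: (@word_exponent i) => // j hj; apply: word3_inj.
have [k ek] : exists k, j = i + k by exists (j - i); lia.
rewrite ek -addnA -!ev; [|lia..]; rewrite pv !nth_mkseq ?/periodic_word -/p ?modnDr //; lia.
Qed.

Lemma word3_avoids_overpals : avoids_overpals word3.
Proof.
move=> v /(is_factorP ord0)[i ev] [a [x def_v]].
set n := (size x).+1.
have size_v : size v = (2 * n).+1 by rewrite def_v !size_cat size_rev /= /n; lia.
have sym k : k <= 2 * n -> word (i + (2 * n - k)) = word (i + k).
  move=> lek; apply: word3_inj; rewrite -!ev; [|lia..].
  have -> : nth ord0 v k = nth ord0 (rev v) k.
    by rewrite def_v !rev_cat revK -!catA.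
  by rewrite nth_rev size_v ?ltnS // subSS.
have mid : word (i + n) = word i.
  apply: word3_inj; rewrite -[in RHS](addn0 i) -!ev; [|lia..].
  by rewrite def_v /= nth_cat ltnn subnn.
have last := sym 0 isT; rewrite subn0 addn0 in last.
(* The overpal is a palindrome of length [2 * n + 1]: [aaa] has period 1 and excess 2, [ababa]
   period 2 and excess 3, and a longer one has a central palindrome of length 7. *)
have [n1|[n2|n3]] : n = 1 \/ n = 2 \/ 3 <= n by rewrite /n; lia.
- rewrite n1 in mid last; have : 22 * 2 <= 19 * 1; last by [].
  apply: (@word_exponent i) => // j hj; have [->|->] : j = i \/ j = i + 1 by lia.
    exact: mid.
  by rewrite -addnA last mid.
- rewrite n2 in mid last sym; have : 22 * 3 <= 19 * 2; last by [].
  apply: (@word_exponent i) => // j hj.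
  have [->|[->|->]] : j = i \/ j = i + 1 \/ j = i + 2 by lia.
  + exact: mid.
  + by rewrite -addnA -(sym 1 isT).
  + by rewrite -addnA last mid.
apply: (@word_palindrome (i + (n - 3))) => j j3.
have -> : i + (n - 3) + 6 - j = i + (2 * n - (n - 3 + j)) by lia.
by rewrite sym -?addnA //; lia.
Qed.

Local Open Scope ring_scope.

Theorem mainTheorem7 :
  exists w : infinite_word 'I_3,
    plus_free (41 / 22 : rat) w /\ avoids_overpals w.
Proof.
by exists word3; split; [exact: word3_plus_free | exact: word3_avoids_overpals].
Qed.
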